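(* $$\pi\sqrt{3}=\frac{9}{64}\sum_{n=0}^{\infty}(-1)^n\left(\frac{3}{4}\right)^{3n}\left[\frac{16}{6n+1}+\frac{24}{6n+2}+\frac{24}{6n+3}+\frac{18}{6n+4}+\frac{9}{6n+5}\right].$$ *)

(* Defs.v *)
From Stdlib Require Import Reals.
From Coquelicot Require Import Coquelicot.

Open Scope R_scope.

Definition pi_sqrt3_term (n : nat) : R :=
  (-1) ^ n * (3 / 4) ^ (3 * n) *
  (16 / (6 * INR n + 1) + 24 / (6 * INR n + 2) + 24 / (6 * INR n + 3)
   + 18 / (6 * INR n + 4) + 9 / (6 * INR n + 5)).

(* Main.v *)
Require Import Defs.
From Stdlib Require Import Reals.
From Coquelicot Require Import Coquelicot.
From Stdlib Require Import Lra Lia.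

Open Scope R_scope.

(** Put [q(x) = - (27/64) x^6].  The term of index [n] is the integral over
    the unit interval of [P(x) q(x)^n], where
    [P(x) = 16 + 24 x + 24 x^2 + 18 x^3 + 9 x^4], so the geometric series turns
    the sum into the integral of [P(x) / (1 + (27/64) x^6)].  With
    [y = (sqrt 3 / 2) x] the denominator is
    [1 + y^6 = (1 + y^2) (1 + sqrt 3 y + y^2) (1 - sqrt 3 y + y^2)], and [P] is
    16 times the product of the first two factors.  What remains is
    [64 / (1 + 3 (x - 1)^2)], whose integral over the unit interval is
    [(64 / sqrt 3) atan (sqrt 3) = 64 PI / (3 sqrt 3)].

    The interchange of sum and integral is elementary: the geometric sum has
    the explicit remainder [q(x)^(n+1) 64 / (1 + 3 (x - 1)^2)], of size at most
    [64 (27/64)^(n+1)] there.  Comparing primitives by the mean value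
    theorem ([partial_sum_error]) carries this bound over to the partial sums
    of the series. *)

Definition ratio (x : R) : R := - (27 / 64) * x ^ 6.

Definition numerator (x : R) : R :=
  16 + 24 * x + 24 * x ^ 2 + 18 * x ^ 3 + 9 * x ^ 4.

Definition limit_integrand (x : R) : R := 64 / (1 + 3 * (x - 1) ^ 2).

Definition limit_primitive (x : R) : R :=
  64 / sqrt 3 * atan (sqrt 3 * (x - 1)).

(** The primitive, vanishing at 0, of [numerator x * ratio x ^ n]; its value
    at 1 is [pi_sqrt3_term n]. *)
Definition term_primitive (n : nat) (x : R) : R :=
  (-1) ^ n * (3 / 4) ^ (3 * n) *
  (16 * x ^ (6 * n + 1) / (6 * INR n + 1)
   + 24 * x ^ (6 * n + 2) / (6 * INR n + 2)
   + 24 * x ^ (6 * n + 3) / (6 * INR n + 3)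
   + 18 * x ^ (6 * n + 4) / (6 * INR n + 4)
   + 9 * x ^ (6 * n + 5) / (6 * INR n + 5)).

Lemma term_primitive_0 n : term_primitive n 0 = 0.
Proof.
  unfold term_primitive.
  rewrite !pow_i by lia.
  unfold Rdiv; ring.
Qed.

Lemma term_primitive_1 n : term_primitive n 1 = pi_sqrt3_term n.
Proof.
  unfold term_primitive, pi_sqrt3_term.
  rewrite !pow1, !Rmult_1_r; reflexivity.
Qed.

Lemma is_derive_monomial (m k : nat) (x : R) :
  is_derive (fun t => t ^ (6 * m + S k) / (6 * INR m + INR (S k))) x
            (x ^ (6 * m + k)).
Proof.
  assert (HE : 6 * INR m + INR (S k) = INR (S (6 * m + k))).
  { rewrite !S_INR, plus_INR, mult_INR; simpl (INR 6); ring. }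
  rewrite HE.
  replace (6 * m + S k)%nat with (S (6 * m + k)) by lia.
  generalize (6 * m + k)%nat; intro j.
  assert (Hj := lt_0_INR (S j) (Nat.lt_0_succ j)).
  auto_derive; [exact I|].
  (* The derivative contains [pred (S j)] and an unfolded [INR (S j)]. *)
  change (Init.Nat.pred (S j)) with j.
  change (match j with 0%nat => 1 | S _ => INR j + 1 end) with (INR (S j)).
  field; lra.
Qed.

Lemma ratio_pow n x :
  (-1) ^ n * (3 / 4) ^ (3 * n) * x ^ (6 * n) = ratio x ^ n.
Proof.
  unfold ratio.
  rewrite !pow_mult, <- !Rpow_mult_distr.
  f_equal; field.
Qed.

Lemma is_derive_term_primitive n x :
  is_derive (term_primitive n) x (numerator x * ratio x ^ n).
Proof.
  pose (f k := fun t : R => t ^ (6 * n + S k) / (6 * INR n + INR (S k))).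
  pose (c := (-1) ^ n * (3 / 4) ^ (3 * n)).
  apply is_derive_ext with
    (f := fun t => c * (16 * f 0%nat t + 24 * f 1%nat t + 24 * f 2%nat t
                        + 18 * f 3%nat t + 9 * f 4%nat t)).
  { intro t; apply (@eq_trans R _ (term_primitive n t)); [|reflexivity].
    unfold term_primitive, f, c, Rdiv; simpl INR.
    replace (1 + 1 + 1 + 1 + 1) with 5 by ring.
    replace (1 + 1 + 1 + 1) with 4 by ring.
    replace (1 + 1 + 1) with 3 by ring.
    replace (1 + 1) with 2 by ring.
    ring. }
  replace (numerator x * ratio x ^ n) with
    (c * (16 * x ^ (6 * n + 0) + 24 * x ^ (6 * n + 1) + 24 * x ^ (6 * n + 2)
          + 18 * x ^ (6 * n + 3) + 9 * x ^ (6 * n + 4))).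
  2: { rewrite <- ratio_pow, !pow_add; unfold numerator, c; ring. }
  assert (Hf : forall a k, is_derive (fun t => a * f k t) x
                                     (a * x ^ (6 * n + k))).
  { intros a k; apply (is_derive_scal (f k)), is_derive_monomial. }
  apply is_derive_scal.
  exact (is_derive_plus _ _ _ _ _ (is_derive_plus _ _ _ _ _
          (is_derive_plus _ _ _ _ _ (is_derive_plus _ _ _ _ _
            (Hf 16 0%nat) (Hf 24 1%nat)) (Hf 24 2%nat)) (Hf 18 3%nat))
          (Hf 9 4%nat)).
Qed.

Lemma is_derive_limit_primitive x :
  is_derive limit_primitive x (limit_integrand x).
Proof.
  assert (Hs : 0 < sqrt 3) by (apply sqrt_lt_R0; lra).
  unfold limit_primitive, limit_integrand.
  auto_derive; [exact I|].
  assert (H := pow2_ge_0 (x - 1)).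
  change (64 / sqrt 3 * (sqrt 3 * 1 * / (1 + (sqrt 3 * (x - 1)) ^ 2))
          = 64 / (1 + 3 * (x - 1) ^ 2)).
  replace (1 + (sqrt 3 * (x - 1)) ^ 2) with (1 + 3 * (x - 1) ^ 2)
    by (rewrite Rpow_mult_distr, pow2_sqrt by lra; ring).
  field; lra.
Qed.

Lemma limit_primitive_increment :
  limit_primitive 1 - limit_primitive 0 = 64 / 9 * (PI * sqrt 3).
Proof.
  assert (Hs : 0 < sqrt 3) by (apply sqrt_lt_R0; lra).
  assert (Hss : sqrt 3 * sqrt 3 = 3) by (apply sqrt_sqrt; lra).
  assert (Hpi := PI_RGT_0).
  assert (Hat : atan (sqrt 3) = PI / 3).
  { rewrite <- tan_PI3; apply atan_tan; lra. }
  unfold limit_primitive.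
  replace (sqrt 3 * (1 - 1)) with 0 by ring.
  replace (sqrt 3 * (0 - 1)) with (- sqrt 3) by ring.
  rewrite atan_0, atan_opp, Hat.
  apply (Rmult_eq_reg_r (sqrt 3)); [|lra].
  replace (64 / 9 * (PI * sqrt 3) * sqrt 3)
    with (64 / 9 * PI * (sqrt 3 * sqrt 3)) by ring.
  rewrite Hss; field; lra.
Qed.

(** [1 - ratio x] and [numerator x] share the factor
    [(1 + (3/4) x^2) (1 + (3/2) x + (3/4) x^2)]; the cofactors are
    [1 - (3/2) x + (3/4) x^2 = (1 + 3 (x - 1)^2) / 4] and 16. *)
Lemma numerator_factor x :
  numerator x = limit_integrand x * (1 - ratio x).
Proof.
  assert (H := pow2_ge_0 (x - 1)).
  unfold numerator, limit_integrand, ratio.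
  field; lra.
Qed.

(** The geometric sum of the derivatives [numerator x * ratio x ^ k], where
    [numerator_factor] cancels the denominator [1 - ratio x]. *)
Lemma is_derive_partial_sum n x :
  is_derive (fun t => sum_n (fun k => term_primitive k t) n) x
            (limit_integrand x * (1 - ratio x ^ S n)).
Proof.
  induction n as [|n IH].
  - apply is_derive_ext with (f := term_primitive 0).
    { intro t; rewrite sum_O; reflexivity. }
    replace (limit_integrand x * (1 - ratio x ^ 1))
      with (numerator x * ratio x ^ 0) by (rewrite numerator_factor; ring).
    apply is_derive_term_primitive.
  - apply is_derive_ext with
      (f := fun t => sum_n (fun k => term_primitive k t) n
                     + term_primitive (S n) t).
    { intro t; rewrite sum_Sn; reflexivity. }
    replace (limit_integrand x * (1 - ratio x ^ S (S n)))
      with (limit_integrand x * (1 - ratio x ^ S n)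
            + numerator x * ratio x ^ S n)
      by (rewrite numerator_factor; simpl; ring).
    exact (is_derive_plus _ _ _ _ _ IH (is_derive_term_primitive (S n) x)).
Qed.

Lemma remainder_bound n x :
  0 <= x <= 1 -> Rabs (limit_integrand x * ratio x ^ n) <= 64 * (27 / 64) ^ n.
Proof.
  intro Hx.
  rewrite Rabs_mult, <- RPow_abs.
  apply Rmult_le_compat.
  - apply Rabs_pos.
  - apply pow_le, Rabs_pos.
  - unfold limit_integrand.
    assert (H := pow2_ge_0 (x - 1)).
    rewrite Rabs_pos_eq by (apply Rdiv_le_0_compat; lra).
    apply Rle_div_l; lra.
  - apply pow_incr; split; [apply Rabs_pos|].
    assert (H0 : 0 <= x ^ 6) by (apply pow_le; lra).
    assert (H1 : x ^ 6 <= 1) by (rewrite <- (pow1 6); apply pow_incr; lra).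
    unfold ratio; apply Rabs_le; lra.
Qed.

(** The difference of [limit_primitive] and the primitive of the partial sum
    has derivative bounded by [remainder_bound] on the unit interval, so its
    increment from 0 to 1 obeys the same bound. *)
Lemma partial_sum_error n :
  Rabs (sum_n pi_sqrt3_term n - 64 / 9 * (PI * sqrt 3))
  <= 64 * (27 / 64) ^ S n.
Proof.
  pose (G := fun t => limit_primitive t
                      - sum_n (fun k => term_primitive k t) n).
  assert (HG : forall t, is_derive G t (limit_integrand t * ratio t ^ S n)).
  { intro t.
    replace (limit_integrand t * ratio t ^ S n) with
      (limit_integrand t - limit_integrand t * (1 - ratio t ^ S n)) by ring.
    exact (is_derive_minus _ _ _ _ _ (is_derive_limit_primitive t)
             (is_derive_partial_sum n t)). }
  destruct (MVT_gen G 0 1 (fun t => limit_integrand t * ratio t ^ S n))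
    as [c [Hc Heq]].
  { intros t _; apply HG. }
  { intros t _; apply continuity_pt_filterlim.
    apply (ex_derive_continuous G t); eexists; apply HG. }
  rewrite Rmin_left, Rmax_right in Hc by lra.
  assert (H0 : sum_n (fun k => term_primitive k 0) n = 0).
  { rewrite (sum_n_ext _ (fun _ => 0)) by apply term_primitive_0.
    rewrite sum_n_const; apply Rmult_0_r. }
  assert (H1 : sum_n (fun k => term_primitive k 1) n = sum_n pi_sqrt3_term n)
    by (apply sum_n_ext, term_primitive_1).
  unfold G in Heq; rewrite H0, H1 in Heq.
  rewrite <- limit_primitive_increment, Rabs_minus_sym.
  replace (limit_primitive 1 - limit_primitive 0 - sum_n pi_sqrt3_term n)
    with (limit_integrand c * ratio c ^ S n) by lra.
  apply remainder_bound, Hc.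
Qed.

Lemma is_series_pi_sqrt3 : is_series pi_sqrt3_term (64 / 9 * (PI * sqrt 3)).
Proof.
  set (l := 64 / 9 * (PI * sqrt 3)).
  change (is_lim_seq (sum_n pi_sqrt3_term) l).
  assert (Hb : is_lim_seq (fun n => 64 * (27 / 64) ^ S n) 0).
  { replace (Finite 0) with (Rbar_mult 64 0) by (simpl; f_equal; ring).
    apply is_lim_seq_scal_l.
    apply (is_lim_seq_incr_1 (fun n => (27 / 64) ^ n)).
    apply is_lim_seq_geom; rewrite Rabs_pos_eq; lra. }
  assert (Hd : is_lim_seq (fun n => sum_n pi_sqrt3_term n - l) 0).
  { apply is_lim_seq_abs_0.
    apply is_lim_seq_le_le with (u := fun _ => 0)
      (w := fun n => 64 * (27 / 64) ^ S n).
    - intro n; split; [apply Rabs_pos | apply partial_sum_error].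
    - apply is_lim_seq_const.
    - exact Hb. }
  apply is_lim_seq_ext with (u := fun n => (sum_n pi_sqrt3_term n - l) + l).
  { intro n; ring. }
  replace (Finite l) with (Finite (0 + l)) by (f_equal; ring).
  apply is_lim_seq_plus'; [exact Hd | apply is_lim_seq_const].
Qed.

Theorem mainTheorem5 :
  ex_series pi_sqrt3_term /\
  PI * sqrt 3 = 9 / 64 * Series pi_sqrt3_term.
Proof.
  split.
  - eexists; apply is_series_pi_sqrt3.
  - rewrite (is_series_unique _ _ is_series_pi_sqrt3); field.
Qed.
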